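(* Let $R$ be a Bézout domain, $W\in R\setminus\{0\}$, let $v_1,v_2$ be divisors of $W$, $u_i=W/v_i$, and let $e_i=e_{v_i}$ ($i=1,2$) be the corresponding elementary factorizations of $W$. Let $a$ be a gcd of $v_1$ and $v_2$, put $b=v_1/a$, $c=v_2/a$, $d=W/(abc)$, let $s$ be a gcd of $a$ and $d$ (so that $(s)=(v_1,v_2,u_1,u_2)$), and put $a'=a/s$, $d'=d/s$. Consider elements of $R$ chosen as follows: $$s_1\in(u_1,v_1)=(s)(a',c)(b,d'),\qquad s_2\in(u_2,v_2)=(s)(a',b)(c,d'),$$ $$u_1'=u_1/s=cd',\quad u_2'=u_2/s=bd',\quad v_1'=v_1/s=a'b,\quad v_2'=v_2/s=a'c,$$ $$x(e_1)\in(s,v_1')=(s,a'b),\qquad y(e_1)\in(s,u_1')=(s,cd'),$$ $$x(e_2)\in(s,v_2')=(s,a'c),\qquad y(e_2)\in(s,u_2')=(s,bd').$$ Then: 1. $e_1$ and $e_2$ are isomorphic in $\mathrm{hef}(R,W)$ if and only if (i) $(s_1)=(s_2)$ and (ii) $\big((x(e_1)),(y(e_1))\big)=\big((x(e_2)),(y(e_2))\big)$ as ordered pairs of elements of $R^\times/U(R)$. 2. $e_1$ and $e_2$ are isomorphic in $\mathrm{HEF}(R,W)$ if and only if (i) $(s_1)=(s_2)$ and (ii) $\big\{(x(e_1)),(y(e_1))\big\}=\big\{(x(e_2)),(y(e_2))\big\}$ as unordered pairs of elements of $R^\times/U(R)$. Moreover, $(s_1)=(s_2)$ implies $(s_1)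=(s)=(s_2)$.
   Context: A Bézout domain is an integral domain in which every finitely generated ideal is principal. $R^\times=R\setminus\{0\}$, $U(R)$ is the group of units, $(x)\in R^\times/U(R)$ is the class of $x$ up to multiplication by units, and $(x_1,\dots,x_n)\in R^\times/U(R)$ denotes the class of gcds of $x_1,\dots,x_n$; products of such classes are taken in the monoid $R^\times/U(R)$. For $W\in R\setminus\{0\}$, a matrix factorization of $W$ is a pair $a=(M,D)$ with $M=M^{\hat 0}\oplus M^{\hat 1}$ a free $\mathbb{Z}_2$-graded $R$-module of finite rank and $D$ an odd endomorphism with $D^2=W\,\mathrm{id}_M$. For two matrix factorizations $(M_1,D_1)$, $(M_2,D_2)$, the $\mathbb{Z}_2$-graded module $\mathrm{Hom}_R(M_1,M_2)$ carries the differential $\mathfrak{d}(f)=D_2\circ f-(-1)^{\kappa}f\circ D_1$ for $f$ of degree $\kappa$. $\mathrm{HMF}(R,W)$ has these objects and morphisms the total ($\mathbb{Z}_2$-graded) cohomology of this differential; $\mathrm{hmf}(R,W)$ keeps only the even cohomology. A matrix factorization is elementary if $M^{\hat 0}$ and $M^{\hat 1}$ have rank one; $\mathrm{HEF}(R,W)$ and $\mathrm{hef}(R,W)$ are the full subcategories of $\mathrm{HMF}(R,W)$ and $\mathrm{hmf}(R,W)$ on elementary factorizations. For a divisor $v$ of $W$, with $u=W/v$, $e_v=(R^{1|1},D_v)$ where $R^{1|1}=R\oplus R$ (even part first) and $D_v=\begin{pmatrix}0&v\\ u&0\end{pmatrix}$.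
   Formalization: In part 2, isomorphisms in HEF(R,W) are required to be homogeneous (even or odd); allowing sums of even and odd classes makes part 2 false, e.g. R = Z, W = 6^5, v_1 = 36, v_2 = 108. *)

(* Defs.v *)
From HB Require Import structures.
From mathcomp Require Import all_boot all_order all_algebra.
Set Implicit Arguments.
Unset Strict Implicit.
Unset Printing Implicit Defensive.
Import GRing.Theory.
Local Open Scope ring_scope.

Section Divisibility.
Variable R : idomainType.
Implicit Types x y g : R.

Definition divides x y : Prop := exists z, y = z * x.

(* Equality of the classes (x) and (y) in the quotient by U(R). *)
Definition associate x y : Prop := exists2 e, e \is a GRing.unit & x = e * y.

(* [is_gcd g xs] : g is a representative of the class of gcds of xs. *)
Definition is_gcd g (xs : seq R) : Prop :=
  (forall x, x \in xs -> divides g x) /\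
  (forall h, (forall x, x \in xs -> divides h x) -> divides h g).

Definition in_ideal n (x : 'I_n -> R) (y : R) : Prop :=
  exists c : 'I_n -> R, y = \sum_(i < n) c i * x i.

End Divisibility.

Definition bezout_domain (R : idomainType) : Prop :=
  forall n (x : 'I_n -> R), exists g : R,
    forall y, in_ideal x y <-> divides g y.

Section MatrixFactorizations.
Variable R : idomainType.

(* A homogeneous map R^(p1|q1) -> R^(p2|q2) of degree kappa (true = odd).
   Matrices act on column vectors, with the even coordinates first, so the
   composite of f followed by g is [g *m f]. *)
Definition homogeneous (kappa : bool) p2 q2 p1 q1
    (f : 'M[R]_(p2 + q2, p1 + q1)) : Prop :=
  if kappa then ulsubmx f = 0 /\ drsubmx f = 0
  else ursubmx f = 0 /\ dlsubmx f = 0.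

(* The free Z/2-graded module of finite rank is presented in a homogeneous
   basis, as R^(mf_rk0 | mf_rk1). *)
Record matrix_factorization (W : R) := MatrixFactorization {
  mf_rk0 : nat;
  mf_rk1 : nat;
  mf_D : 'M[R]_(mf_rk0 + mf_rk1);
  mf_odd : homogeneous true mf_D;
  mf_sqr : mf_D *m mf_D = W%:M
}.

Section Morphisms.
Variable W : R.
Implicit Types a b : matrix_factorization W.

Definition mf_hom a b : Type :=
  'M[R]_(mf_rk0 b + mf_rk1 b, mf_rk0 a + mf_rk1 a).

(* The differential on the component of degree kappa of Hom(a, b). *)
Definition mf_diff a b (kappa : bool) (f : mf_hom a b) : mf_hom a b :=
  mf_D b *m f - (-1) ^+ kappa *: (f *m mf_D a).

Definition cocycle a b (kappa : bool) (f : mf_hom a b) : Prop :=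
  homogeneous kappa f /\ mf_diff kappa f = 0.

(* Equality in the cohomology of degree kappa. *)
Definition cohomologous a b (kappa : bool) (f g : mf_hom a b) : Prop :=
  exists h : mf_hom a b,
    homogeneous (~~ kappa) h /\ f - g = mf_diff (~~ kappa) h.

(* A cohomology class of degree kappa from a to b which is invertible. *)
Definition iso_of_degree (kappa : bool) a b : Prop :=
  exists (f : mf_hom a b) (g : mf_hom b a),
    [/\ cocycle kappa f, cocycle kappa g,
        @cohomologous a a false (g *m f) 1%:M &
        @cohomologous b b false (f *m g) 1%:M].

Definition iso_hmf a b : Prop := iso_of_degree false a b.

(* HMF is a Z/2-graded category, and its isomorphisms are taken to be
   homogeneous, of either degree.  An invertible sum of an even and an odd
   class need not have an invertible homogeneous component: over the integers,
   with W = 6^5, the factorizations (2^2 3^2, 2^3 3^3) and (2^2 3^3, 2^3 3^2)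
   are related by such a sum, but by no homogeneous isomorphism. *)
Definition iso_HMF a b : Prop := exists kappa, iso_of_degree kappa a b.

Record elementary_factorization := ElementaryFactorization {
  ef_mf :> matrix_factorization W;
  ef_rk : mf_rk0 ef_mf = 1%N /\ mf_rk1 ef_mf = 1%N
}.

(* hef and HEF are full subcategories of hmf and HMF. *)
Definition iso_hef (a b : elementary_factorization) : Prop := iso_hmf a b.
Definition iso_HEF (a b : elementary_factorization) : Prop := iso_HMF a b.

End Morphisms.

Definition elem_D (v u : R) : 'M[R]_(1 + 1) := block_mx 0 v%:M u%:M 0.

Lemma elem_D_odd v u : homogeneous true (elem_D v u).
Proof. by rewrite /homogeneous /elem_D block_mxKul block_mxKdr. Qed.

Lemma elem_D_sqr W v u : v * u = W -> elem_D v u *m elem_D v u = W%:M.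
Proof.
move=> <-; rewrite /elem_D mulmx_block !mulmx0 !mul0mx !add0r !addr0.
by rewrite -!scalar_mxM [u * v]mulrC -scalar_mx_block.
Qed.

(* e_v; since R is a domain, u is determined by v when W != 0. *)
Definition elem (W v u : R) (h : v * u = W) : elementary_factorization W :=
  @ElementaryFactorization W
    (MatrixFactorization (elem_D_odd v u) (elem_D_sqr h))
    (conj (erefl 1%N) (erefl 1%N)).

End MatrixFactorizations.

(* Main.v *)
Require Import Defs.
From HB Require Import structures.
From mathcomp Require Import all_boot all_order all_algebra.
From mathcomp Require Import ring.
Import GRing.Theory.
Local Open Scope ring_scope.

(** Write [v1 = a b], [u1 = c d], [v2 = a c], [u2 = b d] with [b], [c] comaximal.
    Since [W] is nonzero, an even cocycle from [e_1] to [e_2] is a diagonal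
    matrix [t diag(c, b)], and one from [e_2] to [e_1] is [t' diag(b, c)]; their
    composites are multiplication by [t t' b c].  Multiplication by [r] on [e_i]
    is homotopic to zero exactly when [s_i] divides [r].  Hence [e_1] and [e_2] are
    isomorphic in the even category iff some multiple of [b c] is congruent to
    [1] modulo both [s1] and [s2], that is, iff [b c] is comaximal with [s1] and
    with [s2] ([scalar_isomorphism_iff]).

    The rest is arithmetic of gcds ([comaximal_gcds_iff]).  With [a = a' s],
    [d = d' s] one has [s1 = gcd (c d' s, a' b s)], [s2 = gcd (b d' s, a' c s)],
    where [b], [c] and [a'], [d'] are comaximal pairs.  The classes of [s1] and
    [s2] agree iff each of [a'], [d'] is comaximal with each of [b], [c], in
    which case both are the class of [s].  Granted this, it remains to compare
    [s] with [b c].  If they are comaximal, then [gcd (s, a' b)] and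
    [gcd (s, a' c)] are both [gcd (s, a')], and likewise for the [y]'s.
    Conversely, a common divisor of [s] and [b] divides [x1], so it divides
    [a' c] when [x1] and [x2] are associate, and [b] is comaximal with [a' c].

    An odd isomorphism from [e_1] to [e_2] amounts to an even one from [e_1] to
    the factorization with [v2] and [u2] exchanged ([odd_isomorphism_iff]).  This
    exchange turns the factors [(a', b, c, d')] into [(b, a', d', c)] and permutes
    [x2] with [y2], so the odd case is an instance of the same two lemmas. *)

(** * Divisibility and comaximality *)

Section Divisibility.
Set Implicit Arguments.
Unset Strict Implicit.
Variable R : idomainType.
Implicit Types a b c d s x y z g h p q r : R.

Lemma divides_refl x : divides x x.
Proof. by exists 1; rewrite mul1r. Qed.

Lemma divides_trans {x} y {z} : divides x y -> divides y z -> divides x z.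
Proof. by move=> [p ->] [q ->]; exists (q * p); rewrite mulrA. Qed.

Lemma divides_mull z {g x} : divides g x -> divides g (z * x).
Proof. by move=> [p ->]; exists (z * p); rewrite mulrA. Qed.

Lemma divides_mulr z {g x} : divides g x -> divides g (x * z).
Proof. by rewrite mulrC; apply: divides_mull. Qed.

Lemma divides_add g x y : divides g x -> divides g y -> divides g (x + y).
Proof. by move=> [p ->] [q ->]; exists (p + q); rewrite mulrDl. Qed.

Lemma divides_mul2r z {g x} : divides g x -> divides (g * z) (x * z).
Proof. by move=> [p ->]; exists p; rewrite mulrA. Qed.

Lemma divides_mul g h x y :
  divides g x -> divides h y -> divides (g * h) (x * y).
Proof. by move=> [p ->] [q ->]; exists (p * q); rewrite mulrACA. Qed.

Lemma associate_divides x y : associate x y -> divides x y.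
Proof.
by move=> [e eU ->]; exists e^-1; rewrite mulrA mulVr // mul1r.
Qed.

Lemma associate_sym x y : associate x y -> associate y x.
Proof.
move=> [e eU ->]; exists e^-1; first by rewrite unitrV.
by rewrite mulrA mulVr // mul1r.
Qed.

Lemma associate_trans x y z : associate x y -> associate y z -> associate x z.
Proof.
move=> [e eU ->] [e' eU' ->]; exists (e * e'); first by rewrite unitrM eU.
by rewrite mulrA.
Qed.

Lemma divides_associate x y : divides x y -> divides y x -> associate x y.
Proof.
move=> [p yE] [q xE]; have [x0|xN0] := eqVneq x 0.
  by exists 1; rewrite ?unitr1 // yE x0 mulr0 mulr0.
exists q => //; apply/unitrPr; exists p; apply: (mulIf xN0).
by rewrite -mulrA -yE -xE mul1r.
Qed.

Lemma is_gcd2P g x y :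
  is_gcd g [:: x; y] <->
  [/\ divides g x, divides g y &
      forall h, divides h x -> divides h y -> divides h g].
Proof.
split=> [[gD gM]|[gx gy gM]].
  split; try by apply: gD; rewrite !inE eqxx ?orbT.
  by move=> h hx hy; apply: gM => z; rewrite !inE => /orP[]/eqP->.
split=> [z|h hD]; first by rewrite !inE => /orP[]/eqP->.
by apply: gM; apply: hD; rewrite !inE eqxx ?orbT.
Qed.

Lemma is_gcd2C g x y : is_gcd g [:: x; y] -> is_gcd g [:: y; x].
Proof.
by move=> /is_gcd2P[gx gy gM]; apply/is_gcd2P; split=> // h hy hx; apply: gM.
Qed.

Lemma is_gcd_unique g h x y :
  is_gcd g [:: x; y] -> is_gcd h [:: x; y] -> associate g h.
Proof.
move=> /is_gcd2P[gx gy gM] /is_gcd2P[hx hy hM].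
by apply: divides_associate; [apply: hM|apply: gM].
Qed.

Lemma is_gcd_of_combination g x y p q :
  divides g x -> divides g y -> g = p * x + q * y -> is_gcd g [:: x; y].
Proof.
move=> gx gy gE; apply/is_gcd2P; split=> // h hx hy; rewrite gE.
by apply: divides_add; apply: divides_mull.
Qed.

(** The ideal form of coprimality; over a Bezout domain it is the absence of
    non-unit common divisors, see [comaximalP]. *)
Definition comaximal x y := exists p q, p * x + q * y = 1.

Lemma comaximal_sym x y : comaximal x y -> comaximal y x.
Proof. by move=> [p [q E]]; exists q, p; rewrite addrC. Qed.

Lemma comaximal_mulr x y z :
  comaximal x y -> comaximal x z -> comaximal x (y * z).
Proof.
move=> [p [q E]] [r [t F]].
(* Expand [(p x + q y) (r x + t z) = 1] and isolate the multiple of [y z]. *)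
exists (p * r * x + p * t * z + q * y * r), (q * t).
by rewrite -[RHS]mulr1 -{1}E -F; ring.
Qed.

Lemma comaximal_mull x y z :
  comaximal x z -> comaximal y z -> comaximal (x * y) z.
Proof.
by move=> /comaximal_sym xz /comaximal_sym yz; apply/comaximal_sym/comaximal_mulr.
Qed.

Lemma comaximal_divr x y z : divides y z -> comaximal x z -> comaximal x y.
Proof. by move=> [t ->] [p [q E]]; exists p, (q * t); rewrite -mulrA. Qed.

Lemma comaximal_divl x y z : divides x z -> comaximal z y -> comaximal x y.
Proof. by move=> xz /comaximal_sym zy; apply/comaximal_sym/(comaximal_divr xz). Qed.

Lemma comaximal_divides1 g x y :
  comaximal x y -> divides g x -> divides g y -> divides g 1.
Proof.
by move=> [p [q <-]] gx gy; apply: divides_add; apply: divides_mull.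
Qed.

Lemma comaximal_gauss x y z : comaximal x y -> divides x (y * z) -> divides x z.
Proof.
move=> [p [q E]] xyz; rewrite -[z]mul1r -E mulrDl -mulrA [x * z]mulrC mulrA.
apply: divides_add; first exact/divides_mull/divides_refl.
by rewrite -mulrA; apply: divides_mull.
Qed.

Lemma comaximal_scaled_gcd s g x y : comaximal x y ->
  is_gcd g [:: y * s; x * s] -> associate g s.
Proof.
move=> [p [q E]] /is_gcd2P[gy gx gM]; apply: divides_associate.
  rewrite -[s]mul1r -E mulrDl -!mulrA.
  by apply: divides_add; apply: divides_mull.
by apply: gM; apply/divides_mull/divides_refl.
Qed.

(** The cross terms [a * d] and [b * c] of the product of the ideals [(a, c)]
    and [(b, d)] lie in [(a * b, c * d)]: multiply them by [1] written as a
    combination of [b, c], respectively of [a, d]. *)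
Lemma gcd_mul_combination a b c d g h : comaximal b c -> comaximal a d ->
  (exists p q, g = p * a + q * c) -> (exists p q, h = p * b + q * d) ->
  exists p q, g * h = p * (c * d) + q * (a * b).
Proof.
move=> [al [be E]] [ga [de F]] [p [q ->]] [m [n ->]].
exists (q * n + p * n * be * a + q * m * de * b),
       (p * m + p * n * al * d + q * m * ga * c).
have -> : (p * a + q * c) * (m * b + n * d) =
  p * m * (a * b) + q * n * (c * d) + p * n * (a * d) * 1 + q * m * (b * c) * 1.
  by ring.
by rewrite -{1}E -F; ring.
Qed.

End Divisibility.

Section Bezout.
Set Implicit Arguments.
Unset Strict Implicit.
Variable R : idomainType.
Hypothesis hR : bezout_domain R.
Implicit Types a b c d s x y z g h p q r : R.

Lemma bezout_gcd x y :
  exists g, [/\ divides g x, divides g y & exists p q, g = p * x + q * y].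
Proof.
have [g gP] := @hR 2%N (fun i => [:: x; y]`_i); exists g.
split; try apply/gP.
- by exists (fun i => (i == 0)%:R); rewrite !big_ord_recl big_ord0 /=; ring.
- by exists (fun i => (i != 0)%:R); rewrite !big_ord_recl big_ord0 /=; ring.
have /gP[e ->] := divides_refl g.
by exists (e 0), (e 1); rewrite !big_ord_recl big_ord0 /= addr0; congr (_ + e _ * _);
  apply/val_inj.
Qed.

(** [bezout_gcd] provides some gcd in the ideal [(x, y)]; it divides the given
    [g], which therefore lies in that ideal as well. *)
Lemma is_gcd_combination g x y :
  is_gcd g [:: x; y] -> exists p q, g = p * x + q * y.
Proof.
move=> /is_gcd2P[_ _ gM]; have [h [hx hy [p [q hE]]]] := bezout_gcd x y.
have [t ->] := gM h hx hy; exists (t * p), (t * q).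
by rewrite hE mulrDr !mulrA.
Qed.

Lemma comaximalP x y :
  comaximal x y <-> forall g, divides g x -> divides g y -> divides g 1.
Proof.
split=> [xy g|H]; first exact: comaximal_divides1.
have [g [gx gy [p [q gE]]]] := bezout_gcd x y.
have [t tE] := H g gx gy; exists (t * p), (t * q).
by rewrite tE gE mulrDr !mulrA.
Qed.

(** The multiplicativity of gcds behind the formulas for [s1] and [s2]. *)
Lemma is_gcd_mul a b c d s g h : comaximal b c -> comaximal a d ->
  is_gcd g [:: a; c] -> is_gcd h [:: b; d] ->
  is_gcd (g * h * s) [:: c * d * s; a * b * s].
Proof.
move=> bc ad G H.
have [p [q E]] := gcd_mul_combination bc ad
  (is_gcd_combination G) (is_gcd_combination H).
have /is_gcd2P[ga gc _] := G; have /is_gcd2P[hb hd _] := H.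
apply: (@is_gcd_of_combination _ _ _ _ p q); last by rewrite E; ring.
- exact/divides_mul2r/divides_mul.
- exact/divides_mul2r/divides_mul.
Qed.

Lemma scaled_common_divisor a b c d s s1 g :
  is_gcd s1 [:: c * d * s; a * b * s] ->
  divides g (a * b) -> divides g (c * d) -> divides (g * s) s1.
Proof.
by move=> /is_gcd2P[_ _ sM] gab gcd; apply: sM; apply: divides_mul2r.
Qed.

(** A common divisor [g] of [a] and [c] divides [a * b] and [c * d], hence
    [b * d]; but it is comaximal with [d], as a divisor of [a], and with [b], as
    a divisor of [c]. *)
Lemma comaximal_of_cross_divides a b c d : comaximal b c -> comaximal a d ->
  (forall g, divides g (a * b) -> divides g (c * d) -> divides g (b * d)) ->
  comaximal a c.
Proof.
move=> bc ad H; apply/comaximalP => g ga gc.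
apply: (@comaximal_divides1 _ g g (b * d)); last 2 first.
- exact: divides_refl.
- by apply: H; [apply: divides_mulr|apply: divides_mulr].
apply: comaximal_mulr; last exact: (comaximal_divl ga).
exact/(comaximal_divl gc)/comaximal_sym.
Qed.

(** After cancelling [s], the pairs [(a * b, c * d)] and [(a * c, b * d)] have the
    same common divisors, so [comaximal_of_cross_divides] applies to all four
    pairs, up to the symmetries exchanging the letters. *)
Lemma cross_comaximal_of_associate a b c d s s1 s2 : s != 0 ->
  comaximal b c -> comaximal a d ->
  is_gcd s1 [:: c * d * s; a * b * s] -> is_gcd s2 [:: b * d * s; a * c * s] ->
  associate s1 s2 ->
  [/\ comaximal a b, comaximal a c, comaximal b d & comaximal c d].
Proof.
move=> s0 bc ad G1 G2 s12.
have cancel g x : divides (g * s) (x * s) -> divides g x.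
  by move=> [t E]; exists t; apply: (mulIf s0); rewrite E mulrA.
have to2 g : divides g (a * b) -> divides g (c * d) ->
    divides g (b * d) /\ divides g (a * c).
  move=> gab gcd; have gs := scaled_common_divisor G1 gab gcd.
  have /is_gcd2P[s2bd s2ac _] := G2.
  have gs2 := divides_trans gs (associate_divides s12).
  by split; apply: cancel; apply: divides_trans gs2 _.
have to1 g : divides g (a * c) -> divides g (b * d) ->
    divides g (c * d) /\ divides g (a * b).
  move=> gac gbd; have gs := scaled_common_divisor G2 gac gbd.
  have /is_gcd2P[s1cd s1ab _] := G1.
  have gs1 := divides_trans gs (associate_divides (associate_sym s12)).
  by split; apply: cancel; apply: divides_trans gs1 _.
have cb := comaximal_sym bc; have da := comaximal_sym ad.
split.
- apply: (@comaximal_of_cross_divides a c b d) => // g gac gbd.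
  by case: (to1 g gac gbd).
- apply: (@comaximal_of_cross_divides a b c d) => // g gab gcd.
  by case: (to2 g gab gcd).
- apply: (@comaximal_of_cross_divides b a d c) => // g.
  by rewrite [b * a]mulrC [d * c]mulrC => gab gcd; case: (to2 g gab gcd).
- apply: (@comaximal_of_cross_divides c a d b) => // g.
  by rewrite [c * a]mulrC [d * b]mulrC [a * b]mulrC => gac gbd;
     case: (to1 g gac gbd) => _; rewrite mulrC.
Qed.

Lemma scaled_gcd_associate a b c d s s1 :
  comaximal a c -> comaximal a d -> comaximal b c -> comaximal b d ->
  is_gcd s1 [:: c * d * s; a * b * s] -> associate s1 s.
Proof.
move=> ac ad bc bd; apply: comaximal_scaled_gcd.
by apply: comaximal_mull; apply: comaximal_mulr.
Qed.

(** The gcd [x] divides [s], so it is comaximal with [b]; as a divisor of [a * b]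
    it then divides [a]. *)
Lemma is_gcd_mul_divides s a b c x y : comaximal b s ->
  is_gcd x [:: s; a * b] -> is_gcd y [:: s; a * c] -> divides x y.
Proof.
move=> bs /is_gcd2P[xs xab _] /is_gcd2P[_ _ yM]; apply: yM => //.
apply/divides_mulr/(@comaximal_gauss _ x b); last by rewrite mulrC.
exact/(comaximal_divl xs)/comaximal_sym.
Qed.

Lemma is_gcd_mul_associate s a b c x y : comaximal b s -> comaximal c s ->
  is_gcd x [:: s; a * b] -> is_gcd y [:: s; a * c] -> associate x y.
Proof.
move=> bs cs X Y; apply: divides_associate.
  exact: is_gcd_mul_divides bs X Y.
exact: is_gcd_mul_divides cs Y X.
Qed.

Lemma comaximal_of_divides_gcd s a b c x y : comaximal b (a * c) ->
  is_gcd x [:: s; a * b] -> is_gcd y [:: s; a * c] -> divides x y ->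
  comaximal b s.
Proof.
move=> bac /is_gcd2P[_ _ xM] /is_gcd2P[_ yac _] xy; apply/comaximalP => g gb gs.
apply: (comaximal_divides1 bac gb); apply: divides_trans yac.
by apply: divides_trans xy; apply: xM => //; apply: divides_mull.
Qed.

(** The left-hand side is the condition for an isomorphism.  It is stated for
    arbitrary letters because the odd case uses it with [(a, b, c, d)] replaced
    by [(b, a, d, c)]. *)
Lemma comaximal_gcds_iff a b c d s s1 s2 x1 y1 x2 y2 : s != 0 ->
  comaximal b c -> comaximal a d ->
  is_gcd s1 [:: c * d * s; a * b * s] -> is_gcd s2 [:: b * d * s; a * c * s] ->
  is_gcd x1 [:: s; a * b] -> is_gcd y1 [:: s; c * d] ->
  is_gcd x2 [:: s; a * c] -> is_gcd y2 [:: s; b * d] ->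
  (comaximal (b * c) s1 /\ comaximal (b * c) s2) <->
  associate s1 s2 /\ (associate x1 x2 /\ associate y1 y2).
Proof.
move=> s0 bc ad G1 G2 X1 Y1 X2 Y2; have cb := comaximal_sym bc; split.
- move=> [bcs1 bcs2].
  have ss1 : divides s s1.
    by have /is_gcd2P[_ _] := G1; apply; apply/divides_mull/divides_refl.
  have bs : comaximal b s.
    apply: comaximal_divl (comaximal_divr ss1 bcs1).
    exact/divides_mulr/divides_refl.
  have cs : comaximal c s.
    apply: comaximal_divl (comaximal_divr ss1 bcs1).
    exact/divides_mull/divides_refl.
  have sub1 g : divides g (a * b) -> divides g (c * d) ->
      divides g (b * c) -> divides g 1.
    move=> gab gcd gbc; apply: (comaximal_divides1 bcs1) => //.
    apply: divides_trans (scaled_common_divisor G1 gab gcd).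
    exact/divides_mulr/divides_refl.
  have sub2 g : divides g (a * c) -> divides g (b * d) ->
      divides g (b * c) -> divides g 1.
    move=> gac gbd gbc; apply: (comaximal_divides1 bcs2) => //.
    apply: divides_trans (scaled_common_divisor G2 gac gbd).
    exact/divides_mulr/divides_refl.
  have ab : comaximal a b.
    by apply/comaximalP => g ga gb; apply: sub2; apply: divides_mulr.
  have ac : comaximal a c.
    apply/comaximalP => g ga gc.
    by apply: sub1; [apply: divides_mulr..|apply: divides_mull].
  have bd : comaximal b d.
    apply/comaximalP => g gb gd.
    by apply: sub1; [apply: divides_mull..|apply: divides_mulr].
  have cd : comaximal c d.
    by apply/comaximalP => g gc gd; apply: sub2; apply: divides_mull.
  split.
    apply: associate_trans (scaled_gcd_associate ac ad bc bd G1) _.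
    exact/associate_sym/(scaled_gcd_associate ab ad cb cd G2).
  split; first exact: is_gcd_mul_associate bs cs X1 X2.
  by rewrite ![_ * d]mulrC in Y1 Y2; apply: is_gcd_mul_associate cs bs Y1 Y2.
(* A common divisor of [s] and [b] divides [x1], one of [s] and [c] divides [x2];
   associate [x1] and [x2] exclude both. *)
move=> [s12 [x12 _]].
have [ab ac bd cd] := cross_comaximal_of_associate s0 bc ad G1 G2 s12.
have ss1 := scaled_gcd_associate ac ad bc bd G1.
have ss2 := scaled_gcd_associate ab ad cb cd G2.
have bs : comaximal b s.
  apply: comaximal_of_divides_gcd X1 X2 (associate_divides x12).
  by apply: comaximal_mulr => //; apply: comaximal_sym.
have cs : comaximal c s.
  apply: comaximal_of_divides_gcd X2 X1 (associate_divides (associate_sym x12)).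
  by apply: comaximal_mulr => //; apply: comaximal_sym.
have bcs := comaximal_mull bs cs.
by split; apply: comaximal_divr bcs; apply: associate_divides.
Qed.

End Bezout.

(** * Morphisms between elementary factorizations *)

Section Matrices.
Set Implicit Arguments.
Unset Strict Implicit.
Variable R : idomainType.
Implicit Types p q v u : R.

Definition diag2 p q : 'M[R]_(1 + 1) := block_mx p%:M 0 0 q%:M.

Lemma scalar11_inj p q : p%:M = q%:M :> 'M[R]_1 -> p = q.
Proof. by move=> /matrixP/(_ 0 0); rewrite !mxE eqxx. Qed.

Lemma diag2_inj p q p' q' : diag2 p q = diag2 p' q' -> p = p' /\ q = q'.
Proof.
by move=> /eq_block_mx[/scalar11_inj ? _ _ /scalar11_inj ?].
Qed.

Lemma elem_D_inj p q p' q' : elem_D p q = elem_D p' q' -> p = p' /\ q = q'.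
Proof.
by move=> /eq_block_mx[_ /scalar11_inj ? /scalar11_inj ? _].
Qed.

Lemma even_diag2P (f : 'M[R]_(1 + 1)) :
  homogeneous false f <-> exists p q, f = diag2 p q.
Proof.
split=> [[ur dl]|[p [q ->]]]; last first.
  by rewrite /homogeneous /diag2 block_mxKur block_mxKdl.
exists (ulsubmx f 0 0), (drsubmx f 0 0).
by rewrite -[LHS]submxK /diag2 -!mx11_scalar; congr block_mx.
Qed.

Lemma odd_elem_DP (f : 'M[R]_(1 + 1)) :
  homogeneous true f <-> exists p q, f = elem_D p q.
Proof.
split=> [[ul dr]|[p [q ->]]]; last exact: elem_D_odd.
exists (ursubmx f 0 0), (dlsubmx f 0 0).
by rewrite -[LHS]submxK /elem_D -!mx11_scalar; congr block_mx.
Qed.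

Lemma diag2_mul p q p' q' : diag2 p q *m diag2 p' q' = diag2 (p * p') (q * q').
Proof. by rewrite mulmx_block !mulmx0 !mul0mx !add0r !addr0 -!scalar_mxM. Qed.

Lemma diag2_mul_elem_D p q v u :
  diag2 p q *m elem_D v u = elem_D (p * v) (q * u).
Proof. by rewrite mulmx_block !mulmx0 !mul0mx !add0r !addr0 -!scalar_mxM. Qed.

Lemma elem_D_mul_diag2 p q v u :
  elem_D v u *m diag2 p q = elem_D (v * q) (u * p).
Proof. by rewrite mulmx_block !mulmx0 !mul0mx !add0r !addr0 -!scalar_mxM. Qed.

Lemma elem_D_mul p q v u : elem_D v u *m elem_D p q = diag2 (v * q) (u * p).
Proof. by rewrite mulmx_block !mulmx0 !mul0mx !add0r !addr0 -!scalar_mxM. Qed.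

Lemma diag2_lin p q k p' q' :
  diag2 p q + k *: diag2 p' q' = diag2 (p + k * p') (q + k * q').
Proof.
by rewrite /diag2 /elem_D scale_block_mx add_block_mx !scaler0 !addr0 !scale_scalar_mx !raddfD.
Qed.

Lemma elem_D_lin p q k p' q' :
  elem_D p q + k *: elem_D p' q' = elem_D (p + k * p') (q + k * q').
Proof.
by rewrite /diag2 /elem_D scale_block_mx add_block_mx !scaler0 !addr0 !scale_scalar_mx !raddfD.
Qed.

Lemma diag2_scalar p : diag2 p p = p%:M.
Proof. by rewrite /diag2 -scalar_mx_block. Qed.

End Matrices.


Section Isomorphisms.
Set Implicit Arguments.
Unset Strict Implicit.
Variables (R : idomainType) (W : R).
Hypothesis hR : bezout_domain R.
Implicit Types a b c d p q v u s : R.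

Lemma even_cocycleP v1 u1 v2 u2 (h1 : v1 * u1 = W) (h2 : v2 * u2 = W)
    (f : mf_hom (elem h1) (elem h2)) :
  cocycle false f <->
  exists p q, f = diag2 p q /\ (v2 * q = p * v1 /\ u2 * p = q * u1).
Proof.
have diffE p q : @mf_diff R W (elem h1) (elem h2) false (diag2 p q) =
    elem_D (v2 * q - p * v1) (u2 * p - q * u1).
  rewrite /mf_diff /= diag2_mul_elem_D elem_D_mul_diag2 -scaleNr elem_D_lin.
  by rewrite expr0 !mulN1r.
have zero : 0 = elem_D 0 0 :> 'M[R]_(1 + 1).
  by rewrite /elem_D raddf0 block_mx0.
split=> [[/even_diag2P[p [q ->]] /eqP]|[p [q [-> [E F]]]]]; last first.
  split; first by apply/even_diag2P; exists p, q.
  by rewrite diffE E F !subrr -zero.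
rewrite diffE zero => /eqP/elem_D_inj[/subr0_eq E /subr0_eq F].
by exists p, q.
Qed.

Lemma odd_cocycleP v1 u1 v2 u2 (h1 : v1 * u1 = W) (h2 : v2 * u2 = W)
    (f : mf_hom (elem h1) (elem h2)) :
  cocycle true f <->
  exists p q, f = elem_D p q /\ (v2 * q = - (p * u1) /\ u2 * p = - (q * v1)).
Proof.
have diffE p q : @mf_diff R W (elem h1) (elem h2) true (elem_D p q) =
    diag2 (v2 * q + p * u1) (u2 * p + q * v1).
  rewrite /mf_diff /= !elem_D_mul -scaleNr diag2_lin.
  by rewrite expr1 opprK !mul1r.
have zero : 0 = diag2 0 0 :> 'M[R]_(1 + 1).
  by rewrite /diag2 raddf0 block_mx0.
split=> [[/odd_elem_DP[p [q ->]] /eqP]|[p [q [-> [E F]]]]]; last first.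
  split; first by apply/odd_elem_DP; exists p, q.
  by rewrite diffE E F !addNr -zero.
rewrite diffE zero => /eqP/diag2_inj[/eqP + /eqP].
by rewrite !addr_eq0 => /eqP E /eqP F; exists p, q.
Qed.

(** For an odd [elem_D m n] both diagonal entries of the differential are
    [m * u + n * v], so the nullhomotopic even endomorphisms are the scalars in
    the ideal [(u, v)], generated by [s]. *)
Lemma cohomologous_id_iff v u (h : v * u = W) s p q : is_gcd s [:: u; v] ->
  @cohomologous R W (elem h) (elem h) false (diag2 p q) 1%:M <->
  p = q /\ divides s (p - 1).
Proof.
move=> G.
have diffE m n : @mf_diff R W (elem h) (elem h) true (elem_D m n) =
    diag2 (m * u + n * v) (m * u + n * v).
  rewrite /mf_diff /= !elem_D_mul -scaleNr diag2_lin.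
  by rewrite expr1 opprK !mul1r; congr diag2; ring.
have subE m n : diag2 m n - 1%:M = diag2 (m - 1) (n - 1) :> 'M[R]_(1 + 1).
  by rewrite -diag2_scalar -scaleN1r diag2_lin !mulN1r.
split=> [[k [/odd_elem_DP[m [n ->]]]]|[<- [t tE]]].
  rewrite subE diffE => /diag2_inj[pE qE]; split.
    by apply: (addIr (-1)); rewrite pE.
  have /is_gcd2P[su sv _] := G.
  by rewrite pE; apply: divides_add; apply: divides_mull.
have [m [n sE]] := is_gcd_combination hR G.
exists (elem_D (t * m) (t * n)); split; first by apply/odd_elem_DP; exists (t * m), (t * n).
by rewrite /= diffE -!mulrA -mulrDr -sE -tE -subE.
Qed.

(** An even isomorphism [diag2 p q] with inverse [diag2 p' q'], in terms of
    entries: the cocycle conditions, then the condition that both composites are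
    homotopic to the identity. *)
Definition scalar_isomorphism v1 u1 v2 u2 s1 s2 : Prop :=
  exists p q p' q',
    [/\ v2 * q = p * v1 /\ u2 * p = q * u1,
        v1 * q' = p' * v2 /\ u1 * p' = q' * u2,
        p' * p = q' * q, divides s1 (p' * p - 1) & divides s2 (p' * p - 1)].

Lemma even_isomorphism_iff v1 u1 v2 u2 (h1 : v1 * u1 = W) (h2 : v2 * u2 = W)
    s1 s2 : is_gcd s1 [:: u1; v1] -> is_gcd s2 [:: u2; v2] ->
  iso_of_degree false (elem h1) (elem h2) <->
  scalar_isomorphism v1 u1 v2 u2 s1 s2.
Proof.
move=> G1 G2; split.
- move=> [f [g [/even_cocycleP[p [q [-> F]]] /even_cocycleP[p' [q' [-> F']]]]]].
  rewrite !diag2_mul => /(cohomologous_id_iff h1 _ _ G1)[E D1].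
  move=> /(cohomologous_id_iff h2 _ _ G2)[_]; rewrite mulrC => D2.
  by exists p, q, p', q'.
- move=> [p [q [p' [q' [F F' E D1 D2]]]]].
  exists (diag2 p q), (diag2 p' q'); split.
  + by apply/even_cocycleP; exists p, q.
  + by apply/even_cocycleP; exists p', q'.
  + by rewrite diag2_mul; apply/(cohomologous_id_iff h1 _ _ G1).
  + rewrite diag2_mul; apply/(cohomologous_id_iff h2 _ _ G2).
    by rewrite [p * p']mulrC [q * q']mulrC.
Qed.

(** Composing an odd map [elem_D p q] with the odd swap of the two summands of
    the target gives [diag2 (- q) p], which is even with target the shifted
    factorization; the sign makes up for the one in the odd differential. *)
Lemma odd_isomorphism_iff v1 u1 v2 u2 (h1 : v1 * u1 = W) (h2 : v2 * u2 = W)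
    s1 s2 : is_gcd s1 [:: u1; v1] -> is_gcd s2 [:: u2; v2] ->
  iso_of_degree true (elem h1) (elem h2) <->
  scalar_isomorphism v1 u1 u2 v2 s1 s2.
Proof.
move=> G1 G2; split.
- move=> [f [g [/odd_cocycleP[p [q [-> [F1 F2]]]]
    /odd_cocycleP[p' [q' [-> [F1' F2']]]]]]].
  rewrite !elem_D_mul => /(cohomologous_id_iff h1 _ _ G1)[E D1].
  move=> /(cohomologous_id_iff h2 _ _ G2)[_]; rewrite mulrC -E => D2.
  exists (- q), p, (- p'), q'; rewrite mulrNN; split=> //.
    by rewrite F2 mulrN F1 opprK mulNr.
  by rewrite F1' mulrN F2' opprK mulNr.
- move=> [p [q [p' [q' [[F1 F2] [F1' F2'] E D1 D2]]]]].
  exists (elem_D q (- p)), (elem_D (- p') q'); split.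
  + by apply/odd_cocycleP; exists q, (- p); rewrite mulrN mulNr opprK F1 F2.
  + by apply/odd_cocycleP; exists (- p'), q'; rewrite mulrN mulNr opprK F1' F2'.
  + by rewrite elem_D_mul mulrNN; apply/(cohomologous_id_iff h1 _ _ G1).
  + rewrite elem_D_mul mulrNN; apply/(cohomologous_id_iff h2 _ _ G2).
    by rewrite [q * q']mulrC -E [p * p']mulrC.
Qed.

(** The cocycle conditions give [c * q = p * b] and [b * q' = p' * c], so [c]
    divides [p] and [b] divides [p'], and [p' * p] is a multiple of [b * c].
    Conversely, if [k * (b * c)] is [1] modulo [s1 * s2], then [diag2 c b] is
    inverted by [k] times [diag2 b c]. *)
Lemma scalar_isomorphism_iff a b c d s1 s2 : a != 0 -> b != 0 -> c != 0 ->
  comaximal b c ->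
  scalar_isomorphism (a * b) (c * d) (a * c) (b * d) s1 s2 <->
  comaximal (b * c) s1 /\ comaximal (b * c) s2.
Proof.
move=> a0 b0 c0 bc; split.
- move=> [p [q [p' [q' [[F _] [F' _] _ D1 D2]]]]].
  have [t pE] : divides c p.
    apply: (comaximal_gauss (comaximal_sym bc)); exists q.
    by apply: (mulfI a0); transitivity (p * (a * b)); [|rewrite -F]; ring.
  have [t' p'E] : divides b p'.
    apply: (comaximal_gauss bc); exists q'.
    by apply: (mulfI a0); transitivity (p' * (a * c)); [|rewrite -F']; ring.
  have comax s : divides s (p' * p - 1) -> comaximal (b * c) s.
    move=> [k kE]; exists (t' * t), (- k); rewrite mulNr -kE pE p'E; ring.
  by split; apply: comax.
- move=> [bcs1 bcs2].
  have [k [l kE]] := comaximal_mulr bcs1 bcs2.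
  have E : k * b * c - 1 = - (l * (s1 * s2)) by rewrite -kE; ring.
  exists c, b, (k * b), (k * c); split.
  + by split; ring.
  + by split; ring.
  + by ring.
  + by rewrite E; exists (- (l * s2)); ring.
  + by rewrite E; exists (- (l * s1)); ring.
Qed.

End Isomorphisms.

Theorem proposition2p16 (R : idomainType) (hR : bezout_domain R)
  (W : R) (hW : W != 0)
  (v1 u1 v2 u2 : R) (h1 : v1 * u1 = W) (h2 : v2 * u2 = W)
  (a b c d s a' d' : R)
  (ha : is_gcd a [:: v1; v2])
  (hb : v1 = a * b) (hc : v2 = a * c) (hd : W = a * b * c * d)
  (hs : is_gcd s [:: a; d]) (ha' : a = a' * s) (hd' : d = d' * s)
  (s1 s2 : R) (hs1 : is_gcd s1 [:: u1; v1]) (hs2 : is_gcd s2 [:: u2; v2])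
  (u1' u2' v1' v2' : R)
  (hu1' : u1 = u1' * s) (hu2' : u2 = u2' * s)
  (hv1' : v1 = v1' * s) (hv2' : v2 = v2' * s)
  (x1 y1 x2 y2 : R)
  (hx1 : is_gcd x1 [:: s; v1']) (hy1 : is_gcd y1 [:: s; u1'])
  (hx2 : is_gcd x2 [:: s; v2']) (hy2 : is_gcd y2 [:: s; u2']) :
  [/\ is_gcd s [:: v1; v2; u1; u2],
      forall g h, is_gcd g [:: a'; c] -> is_gcd h [:: b; d'] ->
        associate s1 (s * g * h),
      forall g h, is_gcd g [:: a'; b] -> is_gcd h [:: c; d'] ->
        associate s2 (s * g * h) &
      [/\ u1' = c * d', u2' = b * d', v1' = a' * b & v2' = a' * c]]
  /\
  (iso_hef (elem h1) (elem h2) <->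
     associate s1 s2 /\ (associate x1 x2 /\ associate y1 y2))
  /\
  (iso_HEF (elem h1) (elem h2) <->
     associate s1 s2 /\
     ((associate x1 x2 /\ associate y1 y2) \/
      (associate x1 y2 /\ associate y1 x2)))
  /\
  (associate s1 s2 -> associate s1 s /\ associate s s2).
Proof.
have : a * b * c * d != 0 by rewrite -hd.
rewrite !mulf_eq0 !negb_or => /andP[/andP[/andP[a0 b0] c0] d0].
move: (a0); rewrite ha' mulf_eq0 negb_or => /andP[a'0 s0].
move: (d0); rewrite hd' mulf_eq0 negb_or => /andP[d'0 _].
have u1E : u1 = c * d.
  by apply: (mulfI (mulf_neq0 a0 b0)); transitivity W; [rewrite -hb|rewrite hd; ring].
have u2E : u2 = b * d.
  by apply: (mulfI (mulf_neq0 a0 c0)); transitivity W; [rewrite -hc|rewrite hd; ring].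
have u1'E : u1' = c * d' by apply: (mulIf s0); rewrite -hu1' u1E hd' mulrA.
have u2'E : u2' = b * d' by apply: (mulIf s0); rewrite -hu2' u2E hd' mulrA.
have v1'E : v1' = a' * b by apply: (mulIf s0); rewrite -hv1' hb ha' mulrAC.
have v2'E : v2' = a' * c by apply: (mulIf s0); rewrite -hv2' hc ha' mulrAC.
have bc : comaximal b c.
  have [p [q E]] := is_gcd_combination hR ha; exists p, q.
  by apply: (mulfI a0); rewrite mulr1 [RHS]E hb hc; ring.
have ad : comaximal a' d'.
  have [p [q E]] := is_gcd_combination hR hs; exists p, q.
  by apply: (mulIf s0); rewrite mul1r [RHS]E ha' hd'; ring.
have cb := comaximal_sym bc.
have G1 : is_gcd s1 [:: c * d' * s; a' * b * s].
  by rewrite -u1'E -v1'E -hu1' -hv1'.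
have G2 : is_gcd s2 [:: b * d' * s; a' * c * s].
  by rewrite -u2'E -v2'E -hu2' -hv2'.
have evenP : iso_of_degree false (elem h1) (elem h2) <->
    associate s1 s2 /\ (associate x1 x2 /\ associate y1 y2).
  rewrite v1'E u1'E v2'E u2'E in hx1 hy1 hx2 hy2.
  rewrite -(comaximal_gcds_iff hR s0 bc ad G1 G2 hx1 hy1 hx2 hy2).
  rewrite -(scalar_isomorphism_iff d s1 s2 a0 b0 c0 bc).
  by rewrite -u1E -u2E -hb -hc; apply: even_isomorphism_iff.
have oddP : iso_of_degree true (elem h1) (elem h2) <->
    associate s1 s2 /\ (associate x1 y2 /\ associate y1 x2).
  have G1' : is_gcd s1 [:: d' * c * s; b * a' * s].
    by rewrite [d' * c]mulrC [b * a']mulrC.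
  rewrite v1'E u1'E v2'E u2'E ?[a' * b]mulrC ?[c * d']mulrC in hx1 hy1 hx2 hy2.
  rewrite -(comaximal_gcds_iff hR s0 ad bc G1' (is_gcd2C G2) hx1 hy1 hy2 hx2).
  (* Here [s] goes with [b] and [c], the gcd of [v1] and [u2] being [b * s]. *)
  have bs0 := mulf_neq0 b0 s0.
  rewrite -(scalar_isomorphism_iff (c * s) s1 s2 bs0 a'0 d'0 ad).
  have -> : b * s * a' = v1 by rewrite hb ha'; ring.
  have -> : d' * (c * s) = u1 by rewrite u1E hd'; ring.
  have -> : b * s * d' = u2 by rewrite u2E hd'; ring.
  have -> : a' * (c * s) = v2 by rewrite hc ha'; ring.
  exact: odd_isomorphism_iff.
split; [split=> [|g h gP hP|g h gP hP|//]|split; [exact: evenP|split]].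
- have [p [q E]] := bc; have /is_gcd2P[sa sd sM] := hs; split=> [x|x xM].
    rewrite !inE hb hc u1E u2E => /or4P[]/eqP->;
      by [apply: divides_mulr|apply: divides_mull].
  apply: sM.
    by have /is_gcd2P[_ _] := ha; apply; apply: xM; rewrite !inE eqxx ?orbT.
  have -> : d = p * u2 + q * u1 by rewrite u1E u2E -[LHS]mul1r -E; ring.
  by apply: divides_add; apply: divides_mull; apply: xM; rewrite !inE eqxx ?orbT.
- rewrite -mulrA mulrC; apply: is_gcd_unique G1 _.
  exact: (is_gcd_mul hR s bc ad gP hP).
- rewrite -mulrA mulrC; apply: is_gcd_unique G2 _.
  exact: (is_gcd_mul hR s cb ad gP hP).
- split=> [[[] /[dup] iso]|[s12 [xy|xy]]].
  + by move=> /oddP[s12 xy]; split=> //; right.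
  + by move=> /evenP[s12 xy]; split=> //; left.
  + by exists false; apply/evenP.
  + by exists true; apply/oddP.
- move=> s12.
  have [ab ac bd cd] := cross_comaximal_of_associate hR s0 bc ad G1 G2 s12.
  split; first exact: scaled_gcd_associate ac ad bc bd G1.
  exact/associate_sym/(scaled_gcd_associate ab ad cb cd G2).
Qed.
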